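(* For every integer $k\ge 3$ and every integer $n\ge 1$, $$\mathrm{LS}_n(12\dots k)=1+\sum_{i=1}^{k-2}\frac{1}{[i-1]_q!}\,c_{k-i+1}\,K_{i,n}.$$
   Context: A restricted growth function (RGF) of length $n$ is a sequence $w=w_1\dots w_n$ of positive integers with $w_1=1$ and $w_i\le 1+\max\{w_1,\dots,w_{i-1}\}$ for $i\ge 2$; $R_n$ is the set of RGFs of length $n$. The standardization of a word replaces every occurrence of its smallest letter by $1$, of its next smallest letter by $2$, and so on. An RGF $w$ contains an RGF $v$ if some subword (subsequence, not necessarily consecutive) of $w$ standardizes to $v$; otherwise $w$ avoids $v$. $R_n(v)$ is the set of $w\in R_n$ avoiding $v$; $12\dots k$ is the RGF with $w_i=i$ for $1\le i\le k$. For a word $w$ and position $j$, $\mathrm{ls}(w_j)$ is the number of distinct values $w_i$ with $i<j$ and $w_i<w_j$, and $\mathrm{ls}(w)=\sum_j\mathrm{ls}(w_j)$; $\mathrm{LS}_n(v)=\sum_{w\in R_n(v)}q^{\mathrm{ls}(w)}$. Notation: $[m]_q=1+q+\dots+q^{m-1}$, $[m]_q!=[1]_q\cdots[m]_q$ with $[0]_q!=1$; $K_{m,n}=\dfrac{[m+1]_q^{\,n-1}-1}{[m]_q}$; and for $k\ge 3$, $c_k=1-\sum_{j=1}^{k-3}\frac{1}{[j]_q!}c_{k-j}$ (so $c_3=1$). *)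

(* Defs.v *)
From HB Require Import structures.
From mathcomp Require Import all_boot all_order all_algebra.
Set Implicit Arguments.
Unset Strict Implicit.
Unset Printing Implicit Defensive.
Import GRing.Theory.

(* Words are sequences of naturals; positions are 0-based, letters are not
   shifted: the letter w_(j+1) of the literature is [nth 0 w j]. *)

Definition is_rgf (w : seq nat) : bool :=
  [&& all (leq 1) w, nth 0 w 0 == 1 &
      [forall i : 'I_(size w),
         (0 < i) ==> (nth 0 w i <= 1 + \max_(a <- take i w) a)]].

Definition standardize (u : seq nat) : seq nat :=
  [seq (index a (sort leq (undup u))).+1 | a <- u].

(* The subwords of w are its masks (see [containsP]). *)
Definition contains (w v : seq nat) : bool :=
  [exists m : (size w).-tuple bool, standardize (mask m w) == v].

Definition avoids (w v : seq nat) : bool := ~~ contains w v.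

Definition ls_at (w : seq nat) (j : nat) : nat :=
  size (undup [seq a <- take j w | a < nth 0 w j]).

Definition ls (w : seq nat) : nat := \sum_(j < size w) ls_at w j.

Definition word n (t : n.-tuple 'I_n.+1) : seq nat := [seq val a | a <- t].

(* Letters of an RGF of length n are at most n, so that n-tuples over 'I_n.+1
   represent all of them exactly once (see [rgf_wordP] and [word_inj]). *)
Definition Rgf (n : nat) (v : seq nat) : {set n.-tuple 'I_n.+1} :=
  [set t | is_rgf (word t) && avoids (word t) v].

Local Open Scope ring_scope.

Definition LS (n : nat) (v : seq nat) : {poly int} :=
  \sum_(t in Rgf n v) 'X^(ls (word t)).

(* The field Q(q), as the fraction field of Z[q]. *)
Definition Qq := {fraction {poly int}}.

Definition toQq : {poly int} -> Qq := @tofrac {poly int}.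

Definition qnum (m : nat) : Qq := toQq (\sum_(i < m) 'X^i).

Definition qfact (m : nat) : Qq := \prod_(1 <= i < m.+1) qnum i.

Definition Kq (m n : nat) : Qq := (qnum m.+1 ^+ n.-1 - 1) / qnum m.

(* [c_rec d k] unfolds the recursion for c_k to depth d; depth k is enough,
   see [cqE]. *)
Fixpoint c_rec (d k : nat) : Qq :=
  if d is d'.+1 then
    1 - \sum_(1 <= j < (k - 2)%N) (qfact j)^-1 * c_rec d' (k - j)%N
  else 1.

Definition cq (k : nat) : Qq := c_rec k k.

Local Close Scope ring_scope.

Lemma containsP w v :
  reflect (exists2 u, subseq u w & standardize u = v) (contains w v).
Proof.
apply: (iffP existsP) => [[m /eqP <-]|[u /subseqP[m sz_m ->] <-]].
  by exists (mask m w); rewrite ?mask_subseq.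
by exists (tcast sz_m (in_tuple m)); rewrite val_tcast.
Qed.

Lemma rgf_nth_le w i : is_rgf w -> i < size w -> nth 0 w i <= i.+1.
Proof.
case/and3P=> _ /eqP w0 /forallP w_rgf.
elim/ltn_ind: i => -[_ _|i IHi lt_i]; first by rewrite w0.
have /= := w_rgf (Ordinal lt_i); move/leq_trans; apply.
rewrite add1n ltnS; apply/bigmax_leqP_seq => a /(nthP 0)[j].
rewrite size_takel ?(ltnW lt_i) // => lt_j <- _; rewrite nth_take //.
exact: leq_trans (IHi j lt_j (ltn_trans lt_j lt_i)) _.
Qed.

Lemma word_inj n : injective (@word n).
Proof. by move=> s t /(inj_map val_inj) /val_inj. Qed.

Lemma rgf_wordP n w :
  is_rgf w -> size w = n -> exists t : n.-tuple 'I_n.+1, word t = w.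
Proof.
move=> w_rgf sz_w; exists [tuple inord (nth 0 w i) | i < n].
apply: (@eq_from_nth _ 0); rewrite size_map size_tuple ?sz_w // => i lt_i.
have -> : nth 0 (word [tuple inord (nth 0 w i) | i < n]) i = (inord (nth 0 w i) : 'I_n.+1).
  rewrite /word (nth_map ord0) ?size_tuple //=.
  by rewrite (nth_map (Ordinal lt_i)) ?size_enum_ord // nth_enum_ord.
rewrite inordK // ltnS.
by apply: leq_trans (rgf_nth_le w_rgf _) _; rewrite ?sz_w.
Qed.

Local Open Scope ring_scope.

Lemma c_rec_stable d e k : (k <= d)%N -> (k <= e)%N -> c_rec d k = c_rec e k.
Proof.
elim: d e k => [|d IHd] [|e] k //=.
- by rewrite leqn0 => /eqP-> _; rewrite big_geq // subr0.
- by move=> _; rewrite leqn0 => /eqP->; rewrite big_geq // subr0.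
move=> led lee; congr (1 - _); apply: eq_big_nat => j /andP[j_gt0 _].
by congr (_ * _); apply: IHd; rewrite leq_subLR (leq_trans _ (leq_add j_gt0 (leqnn _))).
Qed.

Lemma cqE k :
  cq k = 1 - \sum_(1 <= j < (k - 2)%N) (qfact j)^-1 * cq (k - j)%N.
Proof.
rewrite {1}/cq; case: k => [|k] /=; first by rewrite big_geq // subr0.
congr (1 - _); apply: eq_big_nat => j /andP[j_gt0 _]; congr (_ * _).
by apply: c_rec_stable; rewrite // leq_subLR -addn1 addnC leq_add2r.
Qed.

(* Main.v *)
(* In a restricted growth function every value below a letter has already
   occurred, so ls is the sum of (letter - 1), and avoiding 12...k means having
   maximum less than k.  Counting by maximum yields the q-Stirling recursion
   S(n+1, m+1) = [m+1] S(n, m+1) + q^m S(n, m), hence the binomial recursion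
   LS_{n+1}(12...(k+1)) = sum_j C(n, j) q^j LS_j(12...k), which corresponds to
   deleting the ones.  The formula follows by induction on k: by the recursion
   for c_k, the right-hand side is a linear combination of the powers
   [i+1]^{n-1}, and since 1 + q [i+1] = [i+2] the binomial theorem maps
   [i+1]^{n-1} to K_{i+1,n}. *)
Require Import Defs.
From mathcomp Require Import all_boot all_order all_algebra.
From mathcomp Require Import zify ring.
Import GRing.Theory.
Local Open Scope ring_scope.

(** * Restricted growth functions, built letter by letter *)

Local Notation maxw w := (\max_(a <- w) a)%N.

Definition rgf0 (w : seq nat) : bool := (w == [::]) || is_rgf w.

Lemma rgf0_rcons w a :
  rgf0 (rcons w a) = rgf0 w && (0 < a <= (maxw w).+1)%N.
Proof.
rewrite /rgf0; case: (eqVneq w [::]) => [->|w_neq0] /=.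
  rewrite big_nil /is_rgf /= andbT; apply/idP/idP => [/and3P[_ /eqP-> _] //|].
  rewrite -eqn_leq => /eqP <-; rewrite eqxx /=.
  by apply/forallP => -[[|i]].
have -> : (rcons w a == [::]) = false by case: w {w_neq0}.
have w_gt0 : (0 < size w)%N by case: w w_neq0.
rewrite /= /is_rgf all_rcons nth_rcons w_gt0.
apply/idP/idP.
  case/and3P=> /andP[a_gt0 w_pos] w0 /forallP w_rgf; rewrite w_pos w0 a_gt0 /=.
  have lt_last : (size w < size (rcons w a))%N by rewrite size_rcons.
  have /= := w_rgf (Ordinal lt_last).
  rewrite w_gt0 nth_rcons ltnn eqxx -cats1 take_size_cat //= add1n => ->.
  rewrite andbT; apply/forallP => i; apply/implyP => i_gt0.
  have lt_i : (i < size (rcons w a))%N by rewrite size_rcons ltnS ltnW.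
  have /= := w_rgf (Ordinal lt_i).
  by rewrite i_gt0 nth_rcons ltn_ord -cats1 takel_cat // ltnW.
case/andP=> /and3P[-> -> /forallP w_rgf] /andP[-> le_a] /=.
apply/forallP => -[i /=]; rewrite size_rcons ltnS leq_eqVlt.
case/orP=> [/eqP->|lt_i]; apply/implyP => i_gt0.
  by rewrite nth_rcons ltnn eqxx -cats1 take_size_cat // add1n.
have /= := w_rgf (Ordinal lt_i).
by rewrite i_gt0 nth_rcons lt_i -cats1 takel_cat // ltnW.
Qed.

Lemma maxw_rcons w a : maxw (rcons w a) = maxn (maxw w) a.
Proof. by rewrite -cats1 big_cat big_seq1. Qed.

(** Each new maximum exceeds the previous one by exactly one, so no value is skipped. *)
Lemma mem_rgf0 w a : rgf0 w -> (a \in w) = (0 < a <= maxw w)%N.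
Proof.
elim/last_ind: w => [|w b IHw]; first by rewrite big_nil in_nil; case: a.
rewrite rgf0_rcons mem_rcons inE maxw_rcons => /andP[/IHw -> /andP[b_gt0 le_b]].
by lia.
Qed.

Lemma ls_rcons w a :
  rgf0 (rcons w a) -> ls (rcons w a) = (ls w + a.-1)%N.
Proof.
rewrite rgf0_rcons => /andP[w_rgf /andP[a_gt0 le_a]].
rewrite /ls size_rcons big_ord_recr /=; congr (_ + _)%N.
  apply: eq_bigr => i _; rewrite /ls_at nth_rcons ltn_ord -cats1 takel_cat //.
  by rewrite ltnW.
rewrite /ls_at nth_rcons ltnn eqxx -cats1 take_size_cat //.
(* The earlier smaller values are exactly 1, ..., a - 1, because [a.-1] is at most the maximum of
   [w]. *)
rewrite -[RHS](size_iota 1); apply/perm_size/uniq_perm.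
- exact: undup_uniq.
- exact: iota_uniq.
move=> b; rewrite mem_undup mem_filter mem_rgf0 // mem_iota; lia.
Qed.

(** The letters that raise the maximum spell out 1, 2, 3, ... in order. *)
Lemma subseq_iota_maxw w : rgf0 w -> subseq (iota 1 (maxw w)) w.
Proof.
elim/last_ind: w => [|w a IHw]; first by rewrite big_nil.
rewrite rgf0_rcons maxw_rcons => /andP[/IHw sub_w /andP[_ le_a]].
case: (ltnP (maxw w) a) => [lt_a|le_aw].
  have {lt_a le_a} -> : a = (maxw w).+1 by lia.
  rewrite -[X in iota _ X]addn1 iotaD -cats1.
  exact: cat_subseq sub_w (subseq_refl _).
exact: subseq_trans sub_w (subseq_rcons _ _).
Qed.

Lemma standardize_iota k : standardize (iota 1 k) = iota 1 k.
Proof.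
rewrite /standardize undup_id ?iota_uniq // sorted_sort ?iota_sorted //; last first.
  exact: leq_trans.
rewrite -[RHS]map_id; apply/eq_in_map => a; rewrite mem_iota => a_bound.
have lt_a : (a.-1 < k)%N by lia.
have {1}-> : a = nth 0%N (iota 1 k) a.-1 by rewrite nth_iota //; lia.
rewrite index_uniq ?iota_uniq ?size_iota //; lia.
Qed.

Lemma avoids_iota w k : rgf0 w -> avoids w (iota 1 k) = (maxw w < k)%N.
Proof.
move=> w_rgf; rewrite /avoids ltnNge; congr (~~ _); apply/containsP/idP.
  case=> u sub_u std_u.
  have u_uniq : uniq u.
    (* Standardization acts letter by letter, so a repeated letter of [u] would give a repetition in
       [iota 1 k]. *)
    apply: (@map_uniq _ _ (fun a => (index a (sort leq (undup u))).+1)).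
    by rewrite -/(standardize u) std_u iota_uniq.
  have -> : k = size u by rewrite -(size_iota 1 k) -std_u size_map.
  rewrite -(size_iota 1 (maxw w)); apply: uniq_leq_size => // a /(mem_subseq sub_u).
  by rewrite mem_rgf0 // mem_iota add1n ltnS.
move=> le_k; exists (iota 1 k); last exact: standardize_iota.
apply: subseq_trans (subseq_iota_maxw _ w_rgf).
by rewrite -(subnKC le_k) iotaD prefix_subseq.
Qed.

(** * Enumeration by length and maximum *)

Fixpoint rgfs_max (n m : nat) : seq (seq nat) :=
  match n, m with
  | 0, 0 => [:: [::]]
  | n'.+1, m'.+1 =>
      [seq rcons w a | w <- rgfs_max n' m'.+1, a <- iota 1 m'.+1]
      ++ [seq rcons w m'.+1 | w <- rgfs_max n' m']
  | _, _ => [::]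
  end.

Lemma rgfs_maxSS n m :
  rgfs_max n.+1 m.+1 =
    [seq rcons w a | w <- rgfs_max n m.+1, a <- iota 1 m.+1]
    ++ [seq rcons w m.+1 | w <- rgfs_max n m].
Proof. by []. Qed.

Lemma mem_rgfs_max n m (w : seq nat) :
  (w \in rgfs_max n m) = [&& rgf0 w, size w == n & maxw w == m].
Proof.
elim: n m w => [|n IHn] [|m] w.
- rewrite /= inE; case: w => [|a w] /=; first by rewrite big_nil.
  by rewrite andbF.
- rewrite /= in_nil; case: w => [|a w] /=; first by rewrite big_nil.
  by rewrite andbF.
- rewrite /= in_nil; case/lastP: w => [|w a] //=.
  rewrite rgf0_rcons maxw_rcons; lia.
rewrite rgfs_maxSS mem_cat; apply/orP/and3P.
  case=> [/allpairsP[[v a] [+ + ->]]|/mapP[v + ->]].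
    rewrite IHn => /and3P[v_rgf /eqP sz_v /eqP max_v].
    rewrite mem_iota /= => a_bound.
    rewrite rgf0_rcons size_rcons maxw_rcons v_rgf /= sz_v max_v.
    split; lia.
  rewrite IHn => /and3P[v_rgf /eqP sz_v /eqP max_v].
  rewrite rgf0_rcons size_rcons maxw_rcons v_rgf sz_v max_v /=.
  split; lia.
case/lastP: w => [[]|w a] //.
rewrite rgf0_rcons size_rcons maxw_rcons eqSS.
move=> [/andP[w_rgf /andP[a_gt0 le_a]] sz_w max_wa].
(* Either the maximum was reached before the last letter, or the last letter is a new maximum. *)
case: (eqVneq (maxw w) m.+1) => [max_w|neq_m].
  left; apply/allpairsP; exists (w, a); split=> //=.
    by rewrite IHn w_rgf sz_w max_w eqxx.
  by rewrite -[_ :: _]/(iota 1 m.+1) mem_iota; lia.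
right; have -> : a = m.+1 :> nat by lia.
by apply: map_f; rewrite IHn w_rgf sz_w /=; lia.
Qed.

Lemma rgfs_max_uniq n m : uniq (rgfs_max n m).
Proof.
elim: n m => [|n IHn] [|m] //.
rewrite rgfs_maxSS cat_uniq; apply/and3P; split.
- apply: allpairs_uniq; rewrite ?iota_uniq ?IHn // => -[v a] [w b] _ _ /=.
  by move/rcons_inj => [-> ->].
- apply/hasPn => _ /mapP[v v_in ->]; apply/negP => /allpairsP[[w a] /= [w_in _]].
  move/rcons_inj => [eq_vw _]; move: v_in w_in.
  by rewrite eq_vw !mem_rgfs_max; lia.
by rewrite map_inj_uniq // => v w /rcons_inj[].
Qed.

(** The q-Stirling numbers of the second kind, over any ring so that they can be carried from Z[q]
    to Q(q) by [toQq]. *)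
Fixpoint qstirling (R : pzRingType) (q : R) (n m : nat) : R :=
  match n, m with
  | 0, 0 => 1
  | n'.+1, m'.+1 =>
      (\sum_(i < m'.+1) q ^+ i) * qstirling R q n' m'.+1
      + q ^+ m' * qstirling R q n' m'
  | _, _ => 0
  end.
Arguments qstirling {R} q n m.

(** A last letter chosen freely from 1, ..., m contributes the factor [m]; a new maximum m
    contributes q^(m-1). *)
Lemma sum_rgfs_max n m :
  \sum_(w <- rgfs_max n m) 'X^(ls w) = qstirling 'X n m :> {poly int}.
Proof.
elim: n m => [|n IHn] [|m]; rewrite ?big_nil //.
  by rewrite big_seq1 /ls big_ord0 expr0.
rewrite rgfs_maxSS big_cat big_allpairs_dep big_map.
rewrite [RHS]/= -!IHn !mulr_sumr; congr (_ + _).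
  apply: eq_big_seq => w; rewrite mem_rgfs_max => /and3P[w_rgf _ /eqP max_w].
  rewrite mulr_suml -(big_mkord xpredT (fun i => 'X^i * 'X^(ls w))).
  rewrite /index_iota subn0 -[iota 1 _]/(iota (1 + 0) m.+1) iotaDl big_map.
  apply: eq_big_seq => i; rewrite mem_iota => i_bound.
  rewrite ls_rcons ?rgf0_rcons ?w_rgf ?max_w; last by lia.
  by rewrite exprD mulrC.
apply: eq_big_seq => w; rewrite mem_rgfs_max => /and3P[w_rgf _ /eqP max_w].
rewrite ls_rcons ?rgf0_rcons ?w_rgf ?max_w; last by lia.
by rewrite exprD mulrC.
Qed.

Lemma LS_iota n k :
  (0 < n)%N -> LS n (iota 1 k) = \sum_(m < k) qstirling 'X n m.
Proof.
move=> n_gt0; transitivity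
  (\sum_(w <- [seq w | m <- iota 0 k, w <- rgfs_max n m]) 'X^(ls w) : {poly int}).
  rewrite /LS -big_enum -(big_map (@word n) xpredT (fun w => 'X^(ls w))).
  apply: perm_big; apply: uniq_perm.
  - by rewrite (map_inj_uniq (@word_inj n)) enum_uniq.
  - apply: allpairs_uniq_dep; rewrite ?iota_uniq //.
      by move=> m _; exact: rgfs_max_uniq.
    (* No word is listed twice: its index [m] can be recovered as its maximum. *)
    move=> [m v] [m' w] /allpairsPdep[m1 [v1 [_ v1_in [-> ->]]]].
    move=> /allpairsPdep[m2 [w1 [_ w1_in [-> ->]]]] /= eq_vw.
    move: v1_in w1_in; rewrite -eq_vw !mem_rgfs_max.
    by move=> /and3P[_ _ /eqP ->] /and3P[_ _ /eqP ->].
  move=> w; apply/mapP/allpairsPdep.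
    case=> t; rewrite mem_enum inE => /andP[t_rgf t_av] ->.
    have t_rgf0 : rgf0 (word t) by rewrite /rgf0 t_rgf orbT.
    exists (maxw (word t)), (word t); split=> //.
      by rewrite mem_iota /= -avoids_iota.
    by rewrite mem_rgfs_max t_rgf0 size_map size_tuple !eqxx.
  case=> m [v []]; rewrite mem_iota mem_rgfs_max /= => lt_m.
  case/and3P=> v_rgf0 /eqP sz_v /eqP max_v ->.
  have v_rgf : is_rgf v.
    by case/orP: v_rgf0 => // /eqP v0; rewrite -sz_v v0 in n_gt0.
  have [t def_v] := rgf_wordP v_rgf sz_v; exists t => //.
  by rewrite mem_enum inE def_v v_rgf avoids_iota // max_v.
rewrite big_allpairs_dep -(big_mkord xpredT (fun m => qstirling 'X n m)).
by rewrite /index_iota subn0; apply: eq_bigr => m _; exact: sum_rgfs_max.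
Qed.

Lemma rmorph_qstirling (R S : pzRingType) (f : {rmorphism R -> S}) (q : R) n m :
  f (qstirling q n m) = qstirling (f q) n m.
Proof.
elim: n m => [|n IHn] [|m] /=; rewrite ?rmorph0 ?rmorph1 //.
rewrite rmorphD !rmorphM !IHn rmorphXn rmorph_sum; congr (_ * _ + _).
by apply: eq_bigr => i _; rewrite rmorphXn.
Qed.

(** * The binomial recursion for q-Stirling numbers *)

Lemma qnum_recl (R : pzRingType) (q : R) m :
  \sum_(i < m.+1) q ^+ i = 1 + q * \sum_(i < m) q ^+ i.
Proof.
rewrite big_ord_recl expr0 mulr_sumr; congr (_ + _).
by apply: eq_bigr => i _; rewrite exprS.
Qed.

Lemma qstirlingSS (R : pzRingType) (q : R) n m :
  qstirling q n.+1 m.+1 =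
    (\sum_(i < m.+1) q ^+ i) * qstirling q n m.+1 + q ^+ m * qstirling q n m.
Proof. by []. Qed.

Arguments qstirling : simpl never.

(** Here j counts the letters other than 1; lowering each of them by one removes j from [ls]. The
    proof is algebraic, by Pascal's rule and [m+1] = 1 + q[m]. *)
Lemma qstirling_binomial (R : comPzRingType) (q : R) n m :
  qstirling q n.+1 m.+1 = \sum_(j < n.+1) q ^+ j * qstirling q j m *+ 'C(n, j).
Proof.
elim: n m => [|n IHn] m.
  rewrite big_ord1 bin0 mulr1n expr0 mul1r qstirlingSS.
  have -> : qstirling q 0 m.+1 = 0 by [].
  by case: m => [|m]; rewrite mulr0 add0r ?expr0 ?mul1r // mulr0.
have pascal : \sum_(j < n.+2) q ^+ j * qstirling q j m *+ 'C(n.+1, j)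
    = qstirling q n.+1 m.+1
      + q * \sum_(j < n.+1) q ^+ j * qstirling q j.+1 m *+ 'C(n, j).
  rewrite big_ord_recl /= bin0 IHn.
  under eq_bigr => j _ do rewrite binS mulrnDr.
  rewrite big_split /= addrA; congr (_ + _).
    rewrite [in RHS]big_ord_recl bin0 big_ord_recr /= bin_small // mulr0n addr0.
    by congr (_ + _).
  rewrite mulr_sumr; apply: eq_bigr => j _.
  by rewrite -mulrnAr mulrA -exprS mulrnAr.
rewrite pascal qstirlingSS qnum_recl mulrDl mul1r -addrA; congr (_ + _).
case: m {pascal} => [|m].
  rewrite big_ord0 mulr0 mul0r add0r expr0 mul1r.
  rewrite big1 ?mulr0 // => j _.
  have -> : qstirling q j.+1 0 = 0 by [].
  by rewrite mulr0 mul0rn.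
(* Expanding both q-Stirling numbers on the left by induction leaves, for each j, the defining
   recursion of S(j+1, m+1). *)
rewrite -mulrA exprS -mulrA -mulrDr !IHn !mulr_sumr -big_split /= mulr_sumr.
apply: eq_bigr => j _; rewrite qstirlingSS; congr (q * _).
rewrite !mulrnAr -mulrnDl; congr (_ *+ _); ring.
Qed.

(** * The closed form over Q(q) *)

Lemma qnumE m : qnum m = \sum_(i < m) toQq 'X ^+ i.
Proof.
rewrite /qnum /toQq rmorph_sum; apply: eq_bigr => i _; exact: rmorphXn.
Qed.

Lemma qnumS m : qnum m.+1 = 1 + toQq 'X * qnum m.
Proof. by rewrite !qnumE qnum_recl. Qed.

Lemma qnum1 : qnum 1 = 1.
Proof. by rewrite qnumE big_ord1 expr0. Qed.

Lemma qnum_neq0 m : qnum m.+1 != 0.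
Proof.
(* The constant coefficient is 1. *)
rewrite /qnum /toQq tofrac_eq0; apply/eqP => /(congr1 (fun p : {poly int} => p`_0)).
rewrite coef0 coef_sum big_ord_recl expr0 coef1 big1 // => i _.
by rewrite coefXn.
Qed.

Lemma qfact0 : qfact 0 = 1.
Proof. by rewrite /qfact big_geq. Qed.

Lemma qfactS m : qfact m.+1 = qfact m * qnum m.+1.
Proof. by rewrite /qfact big_nat_recr. Qed.

(** In the expansion of (1 + q[i+1])^n the constant term cancels the -1 of [Kq], and every other
    term is divisible by [i+1]. *)
Lemma Kq_binomial i n :
  Kq i.+1 n.+1 = \sum_(j < n) toQq 'X ^+ j.+1 * qnum i.+1 ^+ j *+ 'C(n, j.+1).
Proof.
apply: (mulIf (qnum_neq0 i)); rewrite /Kq divfK ?qnum_neq0 //=.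
rewrite qnumS (addrC 1) exprD1n big_ord_recl bin0 expr0 mulr1n addrC addKr mulr_suml.
by apply: eq_bigr => j _; rewrite lift0 exprMn mulrnAl -mulrA -exprSr.
Qed.

(** The leading 1 is the j = 0 term of the binomial recursion; splitting it off leaves only positive
    lengths, where the closed form applies. *)
Lemma sum_qstirlingS (R : comPzRingType) (q : R) k n :
  \sum_(m < k.+2) qstirling q n.+1 m =
  1 + \sum_(j < n)
        q ^+ j.+1 * (\sum_(m < k.+1) qstirling q j.+1 m) *+ 'C(n, j.+1).
Proof.
rewrite big_ord_recl (_ : qstirling q n.+1 ord0 = 0) // add0r.
under eq_bigr => m _ do rewrite lift0 qstirling_binomial.
rewrite exchange_big big_ord_recl /=; congr (_ + _).
  rewrite big_ord_recl big1 => [|m _]; last by rewrite mulr0 mul0rn.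
  by rewrite addr0 bin0 expr0 mul1r.
by apply: eq_bigr => j _; rewrite mulr_sumr sumrMnl.
Qed.

Lemma sum_qstirling d n :
  \sum_(m < d.+2) qstirling (toQq 'X) n.+1 m =
  1 + \sum_(i < d) (qfact i)^-1 * cq (d.+2 - i) * Kq i.+1 n.+1.
Proof.
elim: d n => [|d IHd] n.
  rewrite big_ord0 sum_qstirlingS big1 // => j _.
  by rewrite big_ord1 mulr0 mul0rn.
rewrite sum_qstirlingS; congr (_ + _).
(* Splitting the -1 off each [Kq], the constants add up to 1 - sum_i c_(d+2-i)/[i+1]!, which is
   c_(d+3), the coefficient of [1]^j = 1. *)
have powers j : \sum_(m < d.+2) qstirling (toQq 'X) j.+1 m
    = \sum_(i < d.+1) (qfact i)^-1 * cq (d.+3 - i) * qnum i.+1 ^+ j.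
  rewrite IHd big_ord_recl subn0 qnum1 expr1n mulr1.
  rewrite qfact0 invr1 mul1r cqE.
  rewrite big_add1 /= big_mkord -addrA; congr (_ + _).
  rewrite -sumrN -big_split /=; apply: eq_bigr => i _.
  rewrite /bump !add1n !subSS /Kq /= qfactS invfM.
  ring.
under eq_bigr => j _ do rewrite powers mulr_sumr -sumrMnl.
rewrite exchange_big; apply: eq_bigr => i _.
rewrite Kq_binomial mulr_sumr; apply: eq_bigr => j _.
by rewrite -mulrnAr; ring.
Qed.

Theorem theorem4p5 (k n : nat) (k_ge3 : (3 <= k)%N) (n_ge1 : (1 <= n)%N) :
  toQq (LS n (iota 1 k)) =
  1 + \sum_(1 <= i < k.-1) (qfact i.-1)^-1 * cq (k - i + 1)%N * Kq i n.
Proof.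
rewrite LS_iota // /toQq rmorph_sum.
under eq_bigr => m _ do rewrite /= rmorph_qstirling.
case: k n k_ge3 n_ge1 => [|[|d]] // [|n] // _ _.
rewrite sum_qstirling big_add1 big_mkord; congr (_ + _).
apply: eq_bigr => -[i lt_i] _; congr (_ * cq _ * _).
by rewrite /=; lia.
Qed.
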